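(* Let $\Delta$ be the clique complex of a chordal graph on vertex set $X$, $|X|=N$, with at least two maximal cliques $S_1,\ldots,S_e$ in a fixed leaf order. Put $n_m=|S_m|$, let $S_{p(m)}$ be a chosen branch of $S_m$ for each $m\ge2$, and set $Q_{m-1}=S_m\cap S_{p(m)}$ and $r_{m-1}=|Q_{m-1}|$. For $m=1,\ldots,e$, set $$g_m=\prod_{x\in X\setminus S_m}x.$$ These are the minimal generators of $I_{\Delta^\vee}$. Join each $S_m$ with $m\ge2$ to its chosen branch $S_{p(m)}$; these edges form a tree on $\{S_1,\ldots,S_e\}$ (a relation tree). Then $I_{\Delta^\vee}$ has the minimal free resolution $$0\longrightarrow\bigoplus_{m=2}^e R\bigl(-(N-r_{m-1})\bigr)\xrightarrow{\ \partial_2\ }\bigoplus_{m=1}^e R\bigl(-(N-n_m)\bigr)\xrightarrow{\ \partial_1\ }I_{\Delta^\vee}\longrightarrow0.$$ Here $\partial_1(e_m)=g_m$, where $e_1,\ldots,e_e$ is the standard basis of the middle module. The column of $\partial_2$ indexed by $m\ge2$ (the $(m-1)$-st column) has exactly two nonzero entries: $$(\partial_2)_{p(m),m-1}=\prod_{x\in S_{p(m)}\setminus S_m}x,\qquad(\partial_2)_{m,m-1}=-\prod_{x\in S_m\setminus S_{p(m)}}x.$$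
   Context: $\mathbb K$ is a field and $R=\mathbb K[x:x\in X]$ with the standard grading. A simplicial complex $\Sigma$ on the finite set $X$ is a collection of subsets (faces) of $X$ closed under inclusion; elements of $X$ not lying in any face (ghost vertices) are allowed. $I_\Sigma\subseteq R$ is generated by the monomials $\prod_{x\in A}x$ with $A\subseteq X$, $A\notin\Sigma$. The Alexander dual on $X$ is $\Sigma^\vee=\{F\subseteq X:X\setminus F\notin\Sigma\}$. The clique complex $\Delta$ of a finite graph consists of its cliques; its facets are the maximal cliques. A leaf order of the facets is an ordering $S_1,\ldots,S_e$ such that for each $m\ge2$ there is $p(m)<m$ (with $S_{p(m)}$ called a branch of $S_m$) satisfying $S_m\cap S_i\subseteq S_m\cap S_{p(m)}$ for all $i<m$; such an order exists when the graph is chordal. Then $Q_{m-1}=S_m\cap(S_1\cup\cdots\cup S_{m-1})$; the $Q$'s may be empty. The edges of the relation tree index the columns of $\partial_2$. *)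

(* Defs.v *)
(* MathComp + multinomials. *)
From HB Require Import structures.
From mathcomp Require Export all_boot all_order all_algebra.
From mathcomp Require Export mpoly.

Set Implicit Arguments.
Unset Strict Implicit.
Unset Printing Implicit Defensive.

Import GRing.Theory.
Local Open Scope ring_scope.

Section Graphs.
Variable T : finType.
Implicit Types (r : rel T) (A V : {set T}).

Definition simple_graph r : Prop := ssrbool.symmetric r /\ irreflexive r.

Definition chordal r : Prop :=
  forall c : seq T, ucycle r c -> (4 <= size c)%N ->
    exists x y : T, [/\ x \in c, y \in c, r x y, y != next c x & x != next c y].

Definition clique r A : bool :=
  [forall x in A, forall y in A, (x != y) ==> r x y].

(* A closed walk x, y, x along an edge is a [ucycle] of size 2, so cycles of
   the graph are the ucycles of size at least 3. *)
Definition is_tree V r : Prop :=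
  [/\ V != set0,
      simple_graph r,
      forall x y, r x y -> (x \in V) && (y \in V),
      {in V &, forall x y, connect r x y}
    & forall c : seq T, ucycle r c -> (size c < 3)%N].

End Graphs.

(* A simplicial complex on X is given by its set of faces; vertices of X lying
   in no face are allowed. *)
Section Complexes.
Variable X : finType.
Implicit Types (Sigma : {set {set X}}) (adj : rel X).

Definition clique_complex adj : {set {set X}} := [set A | clique adj A].

Definition facets Sigma : {set {set X}} :=
  [set F | maxset (fun A : {set X} => A \in Sigma) F].

Definition alexander_dual Sigma : {set {set X}} :=
  [set F : {set X} | ~: F \notin Sigma].

(* The facets are numbered from 0, so that [lift ord0 j] is the (j+2)-nd facet
   and j indexes the facets other than the first. *)
Variable k : nat.
Implicit Types (S : 'I_k.+1 -> {set X}) (p : 'I_k.+1 -> 'I_k.+1).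

Definition is_branch S (m b : 'I_k.+1) : Prop :=
  (b < m)%N /\
  forall i : 'I_k.+1, (i < m)%N -> S m :&: S i \subset S m :&: S b.

Definition leaf_order Sigma S : Prop :=
  [/\ injective S,
      [set S m | m : 'I_k.+1] = facets Sigma
    & forall m : 'I_k.+1, (0 < m)%N -> exists b, is_branch S m b].

Definition relation_tree S p : rel {set X} := fun A B =>
  [exists m : 'I_k.+1, (0 < m)%N &&
     (((A == S m) && (B == S (p m))) || ((A == S (p m)) && (B == S m)))].

Definition branch_meet S p (j : 'I_k) : {set X} :=
  S (lift ord0 j) :&: S (p (lift ord0 j)).

End Complexes.

Definition ideal_gen (R : comNzRingType) (G : R -> Prop) (f : R) : Prop :=
  exists (n : nat) (c g : 'I_n -> R),
    (forall i, G (g i)) /\ f = \sum_i c i * g i.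

Section GradedModules.
Variables (K : fieldType) (n : nat).
Local Notation R := {mpoly K[n]}.

(* A set of monomials generating I, no proper subset of which generates I. *)
Definition minimal_monomial_gens (I G : R -> Prop) : Prop :=
  [/\ forall f, G f -> exists m : 'X_{1..n}, f = 'X_[m],
      forall f, ideal_gen G f <-> I f
    & forall H : R -> Prop, (forall f, H f -> G f) ->
        (forall f, ideal_gen H f <-> I f) -> forall f, G f -> H f].

Definition irrelevant_ideal : R -> Prop :=
  ideal_gen (fun f => exists i : 'I_n, f = 'X_i).

(* u is homogeneous of degree d as an element of the direct sum over i of the
   R(- a i); the component of R(- a i) in degree d is that of R in degree
   d - a i, and is zero when d < a i. *)
Definition twisted_homog (l : nat) (a : 'I_l -> nat) (d : nat) (u : 'cV[R]_l)
  : Prop :=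
  forall i, ((a i <= d)%N -> u i 0 \is (d - a i).-homog) /\
            ((d < a i)%N -> u i 0 = 0).

Definition graded_map (l1 l2 : nat) (a : 'I_l1 -> nat) (b : 'I_l2 -> nat)
  (M : 'M[R]_(l1, l2)) : Prop :=
  forall d (u : 'cV[R]_l2), twisted_homog b d u -> twisted_homog a d (M *m u).

(* 0 -> (+)_j R(- b j) --d2--> (+)_i R(- a i) --d1--> I -> 0 is a minimal
   graded free resolution of I, matrices acting on column vectors. *)
Definition minimal_free_resolution (I : R -> Prop) (l1 l2 : nat)
  (a : 'I_l1 -> nat) (b : 'I_l2 -> nat)
  (d1 : 'rV[R]_l1) (d2 : 'M[R]_(l1, l2)) : Prop :=
  [/\ graded_map (fun _ : 'I_1 => 0%N) a d1 /\ graded_map a b d2,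
      forall v : 'cV[R]_l2, d2 *m v = 0 -> v = 0,
      forall u : 'cV[R]_l1, d1 *m u = 0 <-> exists v : 'cV[R]_l2, u = d2 *m v,
      forall f : R, I f <-> exists u : 'cV[R]_l1, f = (d1 *m u) 0 0
    & forall (v : 'cV[R]_l2) (i : 'I_l1), irrelevant_ideal ((d2 *m v) i 0)].

End GradedModules.

Section StanleyReisner.
Variables (K : fieldType) (X : finType).
Local Notation R := {mpoly K[#|X|]}.

(* The variable attached to x : X is 'X_(enum_rank x). *)
Definition set_monomial (A : {set X}) : R := \prod_(x in A) 'X_(enum_rank x).

Definition SR_ideal (Sigma : {set {set X}}) : R -> Prop :=
  ideal_gen (fun f => exists2 A : {set X}, A \notin Sigma & f = set_monomial A).

Variables (k : nat) (S : 'I_k.+1 -> {set X}) (p : 'I_k.+1 -> 'I_k.+1).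

Definition facet_gen (m : 'I_k.+1) : R := set_monomial (~: S m).

Definition partial1 : 'rV[R]_k.+1 := \row_m facet_gen m.

Definition partial2 : 'M[R]_(k.+1, k) :=
  \matrix_(i, j)
    let m := lift ord0 j in
    if i == p m then set_monomial (S (p m) :\: S m)
    else if i == m then - set_monomial (S m :\: S (p m))
    else 0.

End StanleyReisner.

Arguments set_monomial K {X} A.
Arguments SR_ideal K {X} Sigma f.
Arguments facet_gen K {X k} S m.
Arguments partial1 K {X k} S.
Arguments partial2 K {X k} S p.

(* Main.v *)
Require Import Defs.

Set Implicit Arguments.
Unset Strict Implicit.
Unset Printing Implicit Defensive.

Import GRing.Theory.
Local Open Scope ring_scope.

(** Everything rests on one inclusion: if S_b is a branch of S_m, then S_m
    meets each earlier S_i inside S_b, so S_m \ S_b is contained in S_m \ S_i.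

    The generator g_m is the squarefree monomial of the complement of S_m, and
    the monomial of a face's complement is a multiple of g_m as soon as S_m
    contains the face; hence the g_m generate I.  Facets are pairwise
    incomparable, so no g_m divides another, and an antichain of monomials is
    the unique minimal monomial generating set of the ideal that it generates
    (minimal_monomial_gens_antichain).

    For exactness in the middle, take a syzygy u of the g_i with u_i = 0 for
    i > m.  Then g_m u_m lies in the monomial ideal (g_i : i < m), so every
    term of u_m is divisible by some g_i / gcd(g_i, g_m), the monomial of
    S_m \ S_i (syzygy_supp).  By the inclusion above it is divisible by the
    monomial of S_m \ S_(p m), which up to sign is the entry in row m of the
    column of d2 that belongs to m.  That column vanishes below row m, so a
    multiple of it cancels u_m and the remaining syzygy involves fewer
    generators; if m is the first index there is no i < m, and u_m = 0
    (partial1_ker).  The same triangular shape makes d2 injective, and every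
    entry of d2 is zero or a nontrivial monomial because facets are
    incomparable, which is minimality.

    The relation graph is a tree because p m < m: following p connects every
    facet to the first one, while on a cycle the facet with the largest index
    would have its branch as its only neighbour there
    (relation_tree_is_tree). *)

(** * Ideals generated by a predicate *)

Section IdealGen.
Variable R : comNzRingType.
Implicit Types (G H : R -> Prop) (f g c : R).

Lemma ideal_gen_ind G (P : R -> Prop) :
    P 0 -> (forall f g, P f -> P g -> P (f + g)) ->
    (forall c g, G g -> P (c * g)) ->
  forall f, ideal_gen G f -> P f.
Proof.
move=> P0 PD PG f [n [c [g [Gg ->]]]].
by apply: (big_ind P) => // i _; apply: PG.
Qed.

Lemma ideal_genZ G c g : G g -> ideal_gen G (c * g).
Proof.
by move=> Gg; exists 1%N, (fun=> c), (fun=> g); rewrite big_ord1.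
Qed.

Lemma mem_ideal_gen G g : G g -> ideal_gen G g.
Proof. by rewrite -{2}[g]mul1r; apply: ideal_genZ. Qed.

Lemma ideal_gen0 G : ideal_gen G 0.
Proof.
by exists 0%N, (fun=> 0), (fun=> 0); split=> [[]//|]; rewrite big_ord0.
Qed.

Lemma ideal_genD G f g : ideal_gen G f -> ideal_gen G g -> ideal_gen G (f + g).
Proof.
move=> [n [c [a [Ga ->]]]] [n' [c' [a' [Ga' ->]]]].
pose h T (u : 'I_n -> T) (u' : 'I_n' -> T) (i : 'I_(n + n')) :=
  match split i with inl j => u j | inr j => u' j end.
exists (n + n')%N, (h _ c c'), (h _ a a'); split.
  by move=> i; rewrite /h; case: (split i).
rewrite big_split_ord /= /h; congr (_ + _); apply: eq_bigr => i _.
- by rewrite -[lshift n' i]/(unsplit (inl i)) unsplitK.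
- by rewrite -[rshift n i]/(unsplit (inr i)) unsplitK.
Qed.

Lemma ideal_genM G c f : ideal_gen G f -> ideal_gen G (c * f).
Proof.
move: f; apply: ideal_gen_ind => [|f g If Ig|d g Gg].
- by rewrite mulr0; apply: ideal_gen0.
- by rewrite mulrDr; apply: ideal_genD.
- by rewrite mulrA; apply: ideal_genZ.
Qed.

Lemma ideal_gen_sum G (J : Type) (r : seq J) (P : pred J) (F : J -> R) :
    (forall i, P i -> ideal_gen G (F i)) ->
  ideal_gen G (\sum_(i <- r | P i) F i).
Proof.
move=> GF; apply: (big_ind (ideal_gen G)) => [|f g|//].
- exact: ideal_gen0.
- exact: ideal_genD.
Qed.

Lemma ideal_gen_le G H :
    (forall g, G g -> ideal_gen H g) ->
  forall f, ideal_gen G f -> ideal_gen H f.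
Proof.
move=> GH; apply: ideal_gen_ind => [|f g|c g /GH Hg].
- exact: ideal_gen0.
- exact: ideal_genD.
- exact: ideal_genM.
Qed.

Lemma ideal_gen_row n (g : 'rV[R]_n) f :
  ideal_gen (fun h => exists m, h = g 0 m) f <->
  exists u : 'cV[R]_n, f = (g *m u) 0 0.
Proof.
split=> [|[u ->]]; last first.
  rewrite mxE; apply: ideal_gen_sum => m _; rewrite mulrC.
  by apply: ideal_genZ; exists m.
move: f; apply: ideal_gen_ind => [|_ _ [u ->] [v ->]|c _ [m ->]].
- by exists 0; rewrite mulmx0 mxE.
- by exists (u + v); rewrite mulmxDr [RHS]mxE.
- exists (c *: delta_mx m 0); rewrite mxE (bigD1 m) //= !mxE !eqxx mulr1 mulrC.
  by rewrite big1 ?addr0 // => i /negbTE ne; rewrite !mxE ne !mulr0.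
Qed.

End IdealGen.

(** * Monomial ideals and graded matrices *)

Section MonomialIdeals.
Variables (K : fieldType) (n : nat).
Local Notation R := {mpoly K[n]}.
Implicit Types (f q : R) (a mu : 'X_{1..n}).

Lemma mpolyX_inj : injective (fun a => 'X_[a] : R).
Proof.
move=> a b eq_ab; apply/esym/(mem_msuppXP K); rewrite /= in eq_ab.
by rewrite -eq_ab msuppX inE.
Qed.

Lemma lem_msuppM f a mu : mu \in msupp (f * 'X_[a]) -> (a <= mu)%MM.
Proof.
move/msuppM_le/allpairsP => [[b c] /= [_]].
by rewrite msuppX inE => /eqP -> ->; apply: lem_addl.
Qed.

(** Adding polynomials creates no new exponent and multiplying a monomial only
    raises exponents, so divisibility of every term by some generator passes to
    the whole ideal. *)
Lemma monomial_ideal_supp (G : R -> Prop) :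
    (forall g, G g -> exists a, g = 'X_[a]) ->
  forall f, ideal_gen G f -> forall mu, mu \in msupp f ->
  exists2 a, G 'X_[a] & (a <= mu)%MM.
Proof.
move=> monoG; apply: ideal_gen_ind => [|f g IHf IHg|c g Gg] mu.
- by rewrite msupp0.
- by move/msuppD_le; rewrite mem_cat => /orP[/IHf|/IHg].
- have [a def_g] := monoG g Gg; rewrite def_g in Gg *.
  by move/lem_msuppM; exists a.
Qed.

(** Dividing term by term gives the quotient. *)
Lemma mpolyX_dvd f a :
  (forall mu, mu \in msupp f -> (a <= mu)%MM) -> exists q, f = 'X_[a] * q.
Proof.
move=> le_a; exists (\sum_(mu <- msupp f) f@_mu *: 'X_[mu - a]).
rewrite mulr_sumr [LHS]mpolyE !big_seq; apply: eq_bigr => mu /le_a le_mu.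
by rewrite -scalerAr -mpolyXD addmC submK.
Qed.

(** The minimal generators of a monomial ideal are determined by the ideal, so
    it is enough to exhibit one generating family in which no monomial divides
    another. *)
Lemma minimal_monomial_gens_antichain (J : Type) (a : J -> 'X_{1..n})
    (I G : R -> Prop) :
    (forall i j, (a i <= a j)%MM -> i = j) ->
    (forall f, I f <-> ideal_gen (fun g : R => exists i, g = 'X_[a i]) f) ->
  minimal_monomial_gens I G <-> (forall f, G f <-> exists i, f = 'X_[a i]).
Proof.
move=> anti defI; set A := fun g : R => exists i, g = 'X_[a i].
have monoA g : A g -> exists b, g = 'X_[b] by case=> i ->; exists (a i).
(* Any set of monomials generating I contains a divisor of each 'X_[a i]; that
   divisor, being in I, is itself a multiple of some 'X_[a j]. *)
have genA (H : R -> Prop) : (forall g, H g -> exists b, g = 'X_[b]) ->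
    (forall f, ideal_gen H f <-> I f) -> forall g, A g -> H g.
  move=> monoH defH _ [i ->].
  have Hi : ideal_gen H 'X_[a i].
    by apply/defH/defI/mem_ideal_gen; exists i.
  have [|b Hb le_bi] := monomial_ideal_supp monoH Hi (mu := a i).
    by rewrite msuppX inE.
  have /defH/defI Ib := mem_ideal_gen Hb.
  have [|c [j /mpolyX_inj ->] le_jb] := monomial_ideal_supp monoA Ib (mu := b).
    by rewrite msuppX inE.
  have eq_ji := anti _ _ (lepm_trans le_jb le_bi); rewrite eq_ji in le_jb.
  suff -> : a i = b by [].
  apply/mnmP => x; apply/eqP; rewrite eqn_leq.
  by rewrite (mnm_lepP le_jb) (mnm_lepP le_bi).
split=> [[monoG defG minG] f | defG].
  split=> [Gf|]; last exact: genA.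
  apply: (minG A _ _ f Gf) => [g|g]; first exact: genA.
  exact: iff_sym (defI g).
have monoG g : G g -> exists b, g = 'X_[b] by move/defG/monoA.
split=> // [f|H subHG defH f /defG Af].
  by split=> [If|/defI]; [apply/defI; move: If|];
     apply: ideal_gen_le => g /defG; apply: mem_ideal_gen.
by apply: genA Af => // g /subHG/monoG.
Qed.

(** The entry M i j sends the component of degree d - b j into that of degree
    d - a i. The inequality a i <= b j is needed at nonzero entries since the
    subtraction is truncated. *)
Lemma graded_map_homog l1 l2 (a : 'I_l1 -> nat) (b : 'I_l2 -> nat)
    (M : 'M[R]_(l1, l2)) :
    (forall i j, M i j != 0 ->
       (a i <= b j)%N /\ M i j \is (b j - a i).-homog) ->
  graded_map a b M.
Proof.
move=> homM d u homu i; rewrite mxE; split=> [le_ad|lt_da].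
  apply: rpred_sum => j _; have [->|/homM[le_ab hM]] := eqVneq (M i j) 0.
    by rewrite mul0r; apply: rpred0.
  have [le_bd|/(homu j).2 ->] := leqP (b j) d; last by rewrite mulr0 rpred0.
  have -> : (d - a i = (b j - a i) + (d - b j))%N.
    by rewrite addnC addnBA // subnK.
  exact: dhomogM hM ((homu j).1 le_bd).
apply: big1 => j _; have [->|/homM[le_ab hM]] := eqVneq (M i j) 0.
  by rewrite mul0r.
by rewrite ((homu j).2 (leq_trans lt_da le_ab)) mulr0.
Qed.

End MonomialIdeals.

(** * Squarefree monomials of vertex sets *)

Section SetMonomials.
Variables (K : fieldType) (X : finType).
Local Notation R := {mpoly K[#|X|]}.
Local Notation x_ := (set_monomial K).
Implicit Types A B : {set X}.

(** The exponent of [set_monomial K A]; it turns inclusion of vertex sets into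
    divisibility. *)
Definition set_mnm A : 'X_{1..#|X|} :=
  [multinom ((enum_val i \in A) : nat) | i < #|X|].

Lemma set_mnmE A (x : X) : set_mnm A (enum_rank x) = (x \in A).
Proof. by rewrite mnmE enum_rankK. Qed.

Lemma set_monomialE A : x_ A = 'X_[set_mnm A].
Proof.
rewrite mpolyXE_id /set_monomial (reindex (@enum_rank X)) /=; last first.
  by apply: onW_bij; apply: enum_rank_bij.
rewrite big_mkcond; apply: eq_bigr => x _.
by rewrite set_mnmE; case: (x \in A).
Qed.

Lemma set_mnm_le A B : (set_mnm A <= set_mnm B)%MM = (A \subset B).
Proof.
apply/mnm_lepP/subsetP => [le_AB x Ax | sAB i].
  by have := le_AB (enum_rank x); rewrite !set_mnmE Ax lt0b.
by rewrite !mnmE; case: (boolP (_ \in A)) => // /sAB ->.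
Qed.

Lemma mdeg_set_mnm A : mdeg (set_mnm A) = #|A|.
Proof.
rewrite mdegE (reindex (@enum_rank X)) /=; last first.
  by apply: onW_bij; apply: enum_rank_bij.
rewrite -[RHS]sum1_card [RHS]big_mkcond; apply: eq_bigr => x _.
by rewrite set_mnmE; case: (x \in A).
Qed.

Lemma set_monomial_homog A : x_ A \is #|A|.-homog.
Proof. by rewrite set_monomialE dhomogX /= mdeg_set_mnm. Qed.

Lemma set_monomial_neq0 A : x_ A != 0.
Proof.
by rewrite set_monomialE -msupp_eq0 msuppX.
Qed.

Lemma set_monomial_inj : injective (@set_monomial K X).
Proof.
move=> A B; rewrite !set_monomialE => /mpolyX_inj eqAB.
by apply/eqP; rewrite eqEsubset -!set_mnm_le eqAB lepm_refl.
Qed.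

Lemma set_monomialU A B : [disjoint A & B] -> x_ A * x_ B = x_ (A :|: B).
Proof.
move=> dAB; rewrite /set_monomial -bigU //=.
by apply: eq_bigl => x; rewrite !inE.
Qed.

Lemma set_monomial_sub A B : A \subset B -> x_ B = x_ (B :\: A) * x_ A.
Proof.
move=> sAB; rewrite set_monomialU -?setI_eq0; last first.
  by apply/eqP/setP => x; rewrite !inE; case: (x \in A); rewrite ?andbF.
congr x_; apply/setP => x; rewrite !inE.
by case: (boolP (x \in A)) => [/(subsetP sAB)->|]; rewrite ?orbT ?orbF.
Qed.

Lemma set_monomial_irrelevant A : A != set0 -> irrelevant_ideal (x_ A).
Proof.
case/set0Pn=> x Ax; rewrite /set_monomial (bigD1 x) //= mulrC.
by apply: ideal_genZ; exists (enum_rank x).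
Qed.

End SetMonomials.

(** * The relation tree *)

Section RelationTree.

(** On an edge walked back and forth both neighbours of x coincide; a third
    distinct vertex separates them. *)
Lemma next_neq_prev (T : eqType) (c : seq T) x :
  uniq c -> x \in c -> (2 < size c)%N -> next c x != prev c x.
Proof.
move=> Uc cx gt2; apply/eqP => eq_np.
have: next c (next c x) = x by rewrite eq_np next_prev.
have [i c' def_c] := rot_to cx; rewrite -(size_rot i) in gt2.
have Uc' : uniq (rot i c) by rewrite rot_uniq.
rewrite -!(next_rot i Uc) def_c /= in gt2 Uc' *.
case: c' gt2 Uc' {def_c} => [|y [|z s]] //= _ /and3P[].
rewrite eqxx !inE !negb_or => /and3P[/negbTE ne_xy xz _] _ _.
by rewrite eq_sym ne_xy eqxx => eq_zx; rewrite eq_zx eqxx in xz.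
Qed.

Variables (X : finType) (k : nat) (S : 'I_k.+1 -> {set X}).
Variable p : 'I_k.+1 -> 'I_k.+1.
Hypothesis S_inj : injective S.
Hypothesis p_lt : forall m : 'I_k.+1, (0 < m)%N -> (p m < m)%N.
Local Notation e := (relation_tree S p).

Lemma relation_tree_sym : ssrbool.symmetric e.
Proof.
move=> A B; apply: eq_existsb => m; rewrite orbC.
by rewrite [(A == S (p m)) && _]andbC [(A == S m) && _]andbC.
Qed.

(** An edge joins some facet to its branch, which comes strictly earlier; so the
    later endpoint determines the earlier one. *)
Lemma relation_tree_le m i : e (S m) (S i) -> (i <= m)%N -> i = p m.
Proof.
case/existsP=> l /andP[l_gt0 /orP[]] /andP[/eqP/S_inj em /eqP/S_inj ei].
  by rewrite em ei.
by rewrite em ei leqNgt p_lt.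
Qed.

Lemma relation_tree_mem A B : e A B -> A \in [set S m | m : 'I_k.+1].
Proof.
by case/existsP=> l /andP[_ /orP[]] /andP[/eqP -> _]; apply: imset_f.
Qed.

(** Since p decreases the index, iterating it ends at the first facet. *)
Lemma relation_tree_connect0 m : connect e (S m) (S ord0).
Proof.
have [n] := ubnP (nat_of_ord m); elim: n m => // n IHn m; rewrite ltnS => le_mn.
have [m0|m_gt0] := posnP (m : nat).
  by have -> : m = ord0 by apply: val_inj.
have lt_pm := p_lt m_gt0.
apply: connect_trans (IHn (p m) (leq_trans lt_pm le_mn)).
by apply: connect1; apply/existsP; exists m; rewrite m_gt0 !eqxx.
Qed.

Lemma relation_tree_is_tree : is_tree [set S m | m : 'I_k.+1] e.
Proof.
have symE := relation_tree_sym; split.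
- by apply/set0Pn; exists (S ord0); apply: imset_f.
- split=> // A; apply/existsP => -[m /andP[m_gt0]].
  have neSp : S m != S (p m).
    by rewrite (inj_eq S_inj) neq_ltn orbC p_lt.
  by case/orP=> /andP[/eqP -> E]; [|rewrite eq_sym in E];
     rewrite (negPf neSp) in E.
- move=> A B eAB; rewrite (relation_tree_mem eAB).
  by rewrite symE in eAB; rewrite (relation_tree_mem eAB).
- move=> _ _ /imsetP[m _ ->] /imsetP[i _ ->].
  apply: connect_trans (relation_tree_connect0 m) _.
  by rewrite (sym_connect_sym symE) relation_tree_connect0.
(* Both cycle neighbours of the cycle vertex with the largest index have
   smaller indices, so both are its unique such neighbour. *)
move=> c /andP[cyc Uc]; rewrite ltnNge; apply/negP => gt2.
have cS A : A \in c -> exists i, A = S i.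
  by move=> /(next_cycle cyc)/relation_tree_mem/imsetP[i _ ->]; exists i.
have [i0 ci0] : exists i, S i \in c.
  case def_c: c gt2 => [//|A c'] _; have /cS[i Ei] : A \in c.
    by rewrite def_c mem_head.
  by rewrite Ei in def_c *; exists i; rewrite mem_head.
case: (@arg_maxnP _ i0 (fun i => S i \in c) (@nat_of_ord _) ci0) => m cm max_m.
have nbr A : A \in c -> e (S m) A -> A = S (p m).
  move=> cA; have [i Ei] := cS A cA; rewrite Ei in cA * => emi.
  by congr S; apply: relation_tree_le emi (max_m i cA).
have := next_neq_prev Uc cm gt2; rewrite (nbr (next c (S m))) ?mem_next //.
  rewrite (nbr (prev c (S m))) ?mem_prev ?eqxx // symE.
  exact: prev_cycle.
exact: next_cycle.
Qed.

End RelationTree.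

(** * The resolution given by a leaf order *)

Section Resolution.
Variables (K : fieldType) (X : finType) (k : nat).
Variables (S : 'I_k.+1 -> {set X}) (p : 'I_k.+1 -> 'I_k.+1).
Local Notation R := {mpoly K[#|X|]}.
Local Notation x_ := (set_monomial K).
Local Notation d1 := (partial1 K S).
Local Notation d2 := (partial2 K S p).

(** The colon ideal (g_i : i < m) : g_m is generated by the monomials of the
    sets S m :\: S i; the coefficient of u at m belongs to it. *)
Lemma syzygy_supp (u : 'cV[R]_k.+1) (m : 'I_k.+1) mu :
    d1 *m u = 0 -> (forall i : 'I_k.+1, (m < i)%N -> u i 0 = 0) ->
    mu \in msupp (u m 0) ->
  exists2 i : 'I_k.+1, (i < m)%N & (set_mnm (S m :\: S i) <= mu)%MM.
Proof.
move=> /matrixP/(_ 0 0); rewrite !mxE (bigD1 m) //= mxE => du0 u0 supp_mu.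
pose G (g : R) := exists2 i : 'I_k.+1, (i < m)%N & g = facet_gen K S i.
have monoG g : G g -> exists a, g = 'X_[a].
  by case=> i _ ->; exists (set_mnm (~: S i)); rewrite -set_monomialE.
have Gu : ideal_gen G (u m 0 * facet_gen K S m).
  rewrite mulrC -[_ * _]opprK (addr0_eq du0) -mulN1r; apply: ideal_genM.
  apply: ideal_gen_sum => i; rewrite mxE.
  case: (ltngtP i m) => [lt_im _|lt_mi _|/val_inj ->]; last by rewrite eqxx.
    by rewrite mulrC; apply: ideal_genZ; exists i.
  by rewrite u0 // mulr0; apply: ideal_gen0.
have [|a [i lt_im eq_a] le_a] := monomial_ideal_supp monoG Gu
  (mu := (mu + set_mnm (~: S m))%MM).
  by rewrite mcoeff_msupp /facet_gen set_monomialE addmC mcoeffMX -mcoeff_msupp.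
move: eq_a; rewrite /facet_gen set_monomialE => /mpolyX_inj def_a.
exists i => //; apply/mnm_lepP => y; move/mnm_lepP/(_ y): le_a.
rewrite def_a mnmDE !mnmE !inE.
by case: (_ \in S m); case: (_ \in S i); rewrite ?addn0.
Qed.

Hypothesis S_antichain : forall m i : 'I_k.+1, S m \subset S i -> m = i.
Hypothesis p_branch : forall m : 'I_k.+1, (0 < m)%N -> is_branch S m (p m).
Local Notation above := (lift ord0).

Lemma branch_neq (j : 'I_k) : (above j == p (above j)) = false.
Proof.
apply/negbTE; rewrite neq_ltn orbC.
by have [-> _] := @p_branch (above j) isT.
Qed.

Lemma partial2_branch (j : 'I_k) :
  d2 (p (above j)) j = x_ (S (p (above j)) :\: S (above j)).
Proof. by rewrite mxE /= eqxx. Qed.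

Lemma partial2_facet (j : 'I_k) :
  d2 (above j) j = - x_ (S (above j) :\: S (p (above j))).
Proof. by rewrite mxE /= branch_neq eqxx. Qed.

Lemma partial2_eq0 (i : 'I_k.+1) (j : 'I_k) :
  i != p (above j) -> i != above j -> d2 i j = 0.
Proof. by move=> /negbTE i_p /negbTE i_m; rewrite mxE /= i_p i_m. Qed.

Lemma partial2_neq0 (i : 'I_k.+1) (j : 'I_k) :
  (d2 i j != 0) = (i \in [set p (above j); above j]).
Proof.
rewrite !inE; have [->|i_p] := eqVneq i (p (above j)).
  by rewrite partial2_branch set_monomial_neq0.
have [->|i_m] := eqVneq i (above j).
  by rewrite partial2_facet oppr_eq0 set_monomial_neq0.
by rewrite partial2_eq0 ?eqxx.
Qed.

(** Both terms of a column are the monomial of the complement of the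
    intersection of S_m with S_(p m), the lcm of g_m and g_(p m). *)
Lemma partial1_partial2 : d1 *m d2 = 0.
Proof.
apply/matrixP => i j; rewrite !mxE.
rewrite (bigD1 (above j)) // (bigD1 (p (above j))) /=; last first.
  by rewrite eq_sym branch_neq.
rewrite big1 ?addr0 => [|l /andP[l_m l_p]]; last first.
  by rewrite partial2_eq0 ?mulr0.
rewrite partial2_facet partial2_branch !mxE /facet_gen mulrN.
rewrite !set_monomialU; last 2 first.
- by rewrite -setI_eq0 setDE setIA [~: _ :&: _]setIC setICr set0I.
- by rewrite -setI_eq0 setDE setIA [~: _ :&: _]setIC setICr set0I.
apply/eqP; rewrite addrC subr_eq0; apply/eqP; congr x_; apply/setP => x.
by rewrite !inE; case: (x \in S (above j)); case: (x \in S (p _)).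
Qed.

Lemma partial1_graded : graded_map (fun=> 0%N) (fun m => #|X| - #|S m|)%N d1.
Proof.
apply: graded_map_homog => i m _; rewrite mxE subn0; split=> //.
have -> : (#|X| - #|S m| = #|~: S m|)%N by rewrite [RHS]cardsCs setCK.
exact: set_monomial_homog.
Qed.

Lemma partial2_graded :
  graded_map (fun m => #|X| - #|S m|)%N
             (fun j => #|X| - #|branch_meet S p j|)%N d2.
Proof.
apply: graded_map_homog => i j; rewrite partial2_neq0 !inE.
(* A and B are S_m and S_(p m) in either order: the entry in the row of A is,
   up to sign, the monomial of A :\: B. *)
have homD (A B : {set X}) :
    x_ (A :\: B) \is (#|X| - #|A :&: B| - (#|X| - #|A|)).-homog.
  have -> : (#|X| - #|A :&: B| - (#|X| - #|A|) = #|A :\: B|)%N.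
    by rewrite subnAC subKn ?max_card // -(cardsID B A) addKn.
  exact: set_monomial_homog.
rewrite /branch_meet; case/orP=> /eqP ->; split.
- by rewrite leq_sub2l // subset_leq_card // subsetIr.
- by rewrite partial2_branch setIC homD.
- by rewrite leq_sub2l // subset_leq_card // subsetIl.
- by rewrite partial2_facet dhomogN homD.
Qed.

(** Row m of d2 has a nonzero entry in the column of m and, elsewhere, only in
    columns of later facets whose branch is S_m; so the coordinates of v vanish
    from the last one down. *)
Lemma partial2_inj (v : 'cV[R]_k) : d2 *m v = 0 -> v = 0.
Proof.
move=> d2v; apply/matrixP => j l; rewrite ord1 [RHS]mxE => {l}.
have [n] := ubnP (k - j); elim: n j => // n IHn j; rewrite ltnS => le_n.
move/matrixP/(_ (above j) 0): d2v; rewrite !mxE (bigD1 j) //= big1 => [|l l_j].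
  move/eqP; rewrite addr0 partial2_facet mulf_eq0 oppr_eq0.
  by rewrite (negPf (set_monomial_neq0 _ _)) => /eqP.
have [->|] := eqVneq (d2 (above j) l) 0; first by rewrite mul0r.
rewrite partial2_neq0 !inE => /orP[] /eqP def_j; last first.
  by rewrite (lift_inj def_j) eqxx in l_j.
rewrite IHn ?mulr0 //; have [lt_p _] := @p_branch (above l) isT.
move: lt_p; rewrite -def_j !lift0 ltnS => lt_jl.
by apply: leq_trans le_n; rewrite ltn_sub2l.
Qed.

(** Column reduction from the bottom: the induction is on a bound for the rows
    where the syzygy is nonzero. *)
Lemma partial1_ker (u : 'cV[R]_k.+1) :
  d1 *m u = 0 -> exists v : 'cV[R]_k, u = d2 *m v.
Proof.
suffices kerP n (w : 'cV[R]_k.+1) :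
    d1 *m w = 0 -> (forall i : 'I_k.+1, (n <= i)%N -> w i 0 = 0) ->
    exists v : 'cV[R]_k, w = d2 *m v.
  by move/(kerP k.+1); apply=> i; rewrite leqNgt ltn_ord.
elim: n w => [|n IHn] w d1w w0.
  by exists 0; rewrite mulmx0; apply/matrixP => i l; rewrite ord1 mxE w0.
have [lt_nk|le_kn] := ltnP n k.+1; last first.
  by apply: IHn => // i /(leq_trans le_kn); rewrite leqNgt ltn_ord.
pose m := Ordinal lt_nk; have w_m := syzygy_supp (m := m) d1w w0.
have [j def_m|m0] := unliftP ord0 m; last first.
  apply: IHn => // i; rewrite leq_eqVlt => /orP[/eqP n_i|]; last exact: w0.
  have -> : i = m by apply: val_inj.
  apply/eqP; rewrite -msupp_eq0; case def_s: (msupp _) => [//|mu s].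
  by have [|l] := w_m mu; rewrite ?def_s ?mem_head // m0.
(* S_m meets every earlier S_i inside S_(p m), so each divisor S_m :\: S_i found
   by syzygy_supp contains S_m :\: S_(p m). *)
have [|q def_q] := @mpolyX_dvd _ _ (w m 0) (set_mnm (S m :\: S (p m))).
  move=> mu /w_m[i lt_im]; apply: lepm_trans; rewrite set_mnm_le.
  have [_ /(_ i lt_im)] := p_branch (leq_ltn_trans (leq0n i) lt_im).
  move/subsetP=> sub; apply/subsetP=> x; rewrite !inE => /andP[nSp Sm].
  rewrite Sm andbT; apply: contra nSp => Si.
  by move: (sub x); rewrite !inE Sm Si => /(_ isT).
(* Row m of column j is minus the monomial of S_m :\: S_(p m), so adding q times
   the column cancels coordinate m. *)
have [v def_v] : exists v : 'cV[R]_k, w + d2 *m (q *: delta_mx j 0) = d2 *m v.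
  apply: IHn => [|i le_ni].
    by rewrite mulmxDr d1w mulmxA partial1_partial2 mul0mx addr0.
  have -> : (w + d2 *m (q *: delta_mx j 0)) i 0 = w i 0 + q * d2 i j.
    by rewrite -scalemxAr -colE !mxE.
  have [->|i_m] := eqVneq i m.
    rewrite def_q def_m partial2_facet -def_m set_monomialE.
    by rewrite mulrN [q * _]mulrC subrr.
  have lt_mi : (m < i)%N by rewrite ltn_neqAle eq_sym i_m.
  rewrite w0 // partial2_eq0 -?def_m ?mulr0 ?addr0 // neq_ltn orbC.
  have [lt_pm _] : is_branch S m (p m) by apply: p_branch; rewrite def_m.
  by rewrite (ltn_trans lt_pm lt_mi).
exists (v - q *: delta_mx j 0).
by rewrite mulmxBr -def_v addrK.
Qed.

Lemma partial2_minimal (v : 'cV[R]_k) i : irrelevant_ideal ((d2 *m v) i 0).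
Proof.
rewrite mxE; apply: ideal_gen_sum => j _; rewrite mulrC.
have [->|] := eqVneq (d2 i j) 0; first by rewrite mulr0; apply: ideal_gen0.
have ne := branch_neq j.
have Sx (a b : 'I_k.+1) : a != b -> S a :\: S b != set0.
  by apply: contraNneq => /eqP; rewrite setD_eq0 => /S_antichain ->.
rewrite partial2_neq0 !inE => /orP[] /eqP ->; apply: ideal_genM.
  rewrite partial2_branch.
  by apply/set_monomial_irrelevant/Sx; rewrite eq_sym ne.
rewrite partial2_facet -mulN1r; apply: ideal_genM.
by apply/set_monomial_irrelevant/Sx; rewrite ne.
Qed.

End Resolution.


Theorem theorem4 (K : fieldType) (X : finType) (adj : rel X)
  (adj_simple : simple_graph adj) (adj_chordal : chordal adj)
  (two_facets : (2 <= #|facets (clique_complex adj)|)%N)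
  (k : nat) (S : 'I_k.+1 -> {set X})
  (S_leaf : leaf_order (clique_complex adj) S)
  (p : 'I_k.+1 -> 'I_k.+1)
  (p_branch : forall m : 'I_k.+1, (0 < m)%N -> is_branch S m (p m)) :
  let I := SR_ideal K (alexander_dual (clique_complex adj)) in
  [/\ injective (facet_gen K S)
      /\ (forall G : {mpoly K[#|X|]} -> Prop,
            minimal_monomial_gens I G <->
            (forall f, G f <-> exists m, f = facet_gen K S m)),
      is_tree [set S m | m : 'I_k.+1] (relation_tree S p),
      (forall j : 'I_k, let m := lift ord0 j in
         [/\ partial2 K S p (p m) j = set_monomial K (S (p m) :\: S m),
             partial2 K S p m j = - set_monomial K (S m :\: S (p m))
           & forall i : 'I_k.+1,
               (partial2 K S p i j != 0) = (i \in [set p m; m])])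
    & minimal_free_resolution I
        (fun m : 'I_k.+1 => (#|X| - #|S m|)%N)
        (fun j : 'I_k => (#|X| - #|branch_meet S p j|)%N)
        (partial1 K S) (partial2 K S p)].
Proof.
move=> I; have [S_inj S_facets _] := S_leaf.
have S_antichain (m i : 'I_k.+1) : S m \subset S i -> m = i.
  move=> sub; apply: S_inj; apply/esym.
  have /maxsetP[_ maxS] : maxset (mem (clique_complex adj)) (S m).
    have: S m \in facets (clique_complex adj) by rewrite -S_facets imset_f.
    by rewrite inE.
  have /maxsetP[Si _] : maxset (mem (clique_complex adj)) (S i).
    have: S i \in facets (clique_complex adj) by rewrite -S_facets imset_f.
    by rewrite inE.
  exact: maxS.
have I_gens f : I f <-> ideal_gen (fun g => exists m, g = facet_gen K S m) f.
  split; apply: ideal_gen_le => g; last first.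
    case=> m ->; apply: mem_ideal_gen; exists (~: S m) => //.
    rewrite inE negbK setCK.
    have: S m \in facets (clique_complex adj) by rewrite -S_facets imset_f.
    by rewrite inE => /maxsetP[].
  case=> A; rewrite inE negbK => cA ->.
  have [F maxF sub] := maxset_exists (P := mem (clique_complex adj)) cA.
  have: F \in facets (clique_complex adj) by rewrite inE.
  rewrite -S_facets => /imsetP[m _ def_F].
  rewrite (@set_monomial_sub _ _ (~: S m)); last by rewrite -subCset -def_F.
  by apply: ideal_genZ; exists m.
split.
- split=> [m i /set_monomial_inj/setC_inj/S_inj //|G].
  have gE m : facet_gen K S m = 'X_[set_mnm (~: S m)] by rewrite -set_monomialE.
  have anti m i : (set_mnm (~: S m) <= set_mnm (~: S i))%MM -> m = i.
    by rewrite set_mnm_le setCS => /S_antichain.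
  apply: iff_trans (minimal_monomial_gens_antichain G anti (I := I) _) _.
    move=> f; apply: iff_trans (I_gens f) _.
    by split; apply: ideal_gen_le => g [m ->]; apply: mem_ideal_gen; exists m.
  by split=> defG f; rewrite defG; split=> -[m ->]; exists m.
- by apply: relation_tree_is_tree => // m /p_branch[].
- move=> j m; split; first exact: partial2_branch.
    exact: partial2_facet.
  by move=> i; apply: partial2_neq0.
split.
- split; first exact: partial1_graded.
  exact: partial2_graded.
- exact: partial2_inj.
- move=> u; split=> [|[v ->]]; first exact: partial1_ker.
  by rewrite mulmxA partial1_partial2 // mul0mx.
- move=> f; apply: iff_trans (I_gens f) _.
  apply: iff_trans (ideal_gen_row (partial1 K S) f).
  by split; apply: ideal_gen_le => g [m ->]; apply: mem_ideal_gen; exists m;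
     rewrite mxE.
exact: partial2_minimal.
Qed.
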